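(* Given $u:\mathbb R\to sl(n)_a^\perp$ (smooth), if $a\lambda+u$ satisfies the $GD_n$-reality condition, then for every $j\ge0$ the Lax pair of the $(nj+1)$-th flow in the $sl(n,\mathbb C)$-hierarchy (defined by $a$) satisfies the $GD_n$-reality condition; that is, both $a\lambda+u$ and $$a\lambda^{nj+1}+u\lambda^{nj}+Q_{a,2}(u)\lambda^{nj-1}+\dots+Q_{a,nj+1}(u)$$ satisfy it.
   Context: Let $\alpha=e^{2\pi i/n}$, $a=\mathrm{diag}(1,\alpha,\dots,\alpha^{n-1})$; $sl(n)_a^\perp$ is the space of complex $n\times n$ matrices with zero diagonal (the trace-orthogonal complement of the centralizer of $a$ in $sl(n,\mathbb C)$). For smooth $u$ with values in $sl(n)_a^\perp$: $Q_{a,0}(u)=a$, and $Q_{a,k}(u)$, $k\ge1$, are the unique matrix-valued polynomials without constant term in the entries of $u$ and their $x$-derivatives such that $(Q_{a,k}(u))_x+[u,Q_{a,k}(u)]=[Q_{a,k+1}(u),a]$ for all $k\ge0$ (so $Q_{a,1}(u)=u$). The Lax pair of the $l$-th flow is the pair $A(\lambda)=a\lambda+u$, $B(\lambda)=a\lambda^l+Q_{a,1}(u)\lambda^{l-1}+\dots+Q_{a,l}(u)$. Let $V(\lambda)$ be the $n\times n$ matrix with $(i,j)$ entry $(\alpha^{i-1}\lambda)^{j-1}$; it factors uniquely as $V(\lambda)=\phi_n^-(\lambda)\phi_n(\lambda)$ with $\phi_n^-$ lower triangular and $\phi_n$ upper triangular with $1$'s on the diagonal, and $\phi_n$ is polynomial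 in $\lambda$. A matrix function $A(\lambda)$ satisfies the $GD_n$-reality condition if $\phi_n(\lambda)^{-1}A(\lambda)\phi_n(\lambda)=\phi_n(\alpha\lambda)^{-1}A(\alpha\lambda)\phi_n(\alpha\lambda)$ for all $\lambda$. *)

(* Defs.v *)
From HB Require Import structures.
From mathcomp Require Import all_boot all_order all_algebra.
From mathcomp Require Import finmap.
From mathcomp.multinomials Require Import monalg.
From mathcomp Require Import all_classical all_reals all_analysis.
From mathcomp.real_closed Require Import complex.

Set Implicit Arguments.
Unset Strict Implicit.
Unset Printing Implicit Defensive.

Import Order.TTheory GRing.Theory Num.Theory.
Import numFieldNormedType.Exports.

Local Open Scope ring_scope.
Local Open Scope complex_scope.

Section GelfandDickeyDefs.
Context {R : realType}.
Local Notation C := R[i].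

Definition alpha (n : nat) : C :=
  cos (2 * pi / n%:R) +i* sin (2 * pi / n%:R).

Definition amx (n : nat) : 'M[C]_n := diag_mx (\row_i alpha n ^+ i).

(* Derivatives of complex-valued functions of a real variable are taken on
   the real and imaginary parts; [derive1n] is total, so these are only
   meaningful together with smoothness. *)
Definition cderiven (k : nat) (f : R -> C) (x : R) : C :=
  derive1n k (fun y => complex.Re (f y)) x +i*
  derive1n k (fun y => complex.Im (f y)) x.

Definition csmooth (f : R -> C) : Prop :=
  forall (k : nat) (x : R),
    derivable (derive1n k (fun y => complex.Re (f y))) x 1 /\
    derivable (derive1n k (fun y => complex.Im (f y))) x 1.

Definition mxsmooth n (u : R -> 'M[C]_n) : Prop :=
  forall i j, csmooth (fun x => u x i j).

Definition mxderiv n (M : R -> 'M[C]_n) (x : R) : 'M[C]_n :=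
  \matrix_(i, j) cderiven 1 (fun y => M y i j) x.

Definition zero_diag n (u : R -> 'M[C]_n) : Prop :=
  forall x i, u x i i = 0.

Definition mxcomm n (A B : 'M[C]_n) : 'M[C]_n := A *m B - B *m A.

(* The variable [(i, j, k)] stands for the k-th x-derivative of the entry
   (i, j) of u. *)
Definition jetvar (n : nat) : choiceType := ('I_n * 'I_n * nat)%type.

Definition dpoly (n : nat) : Type := {malg C[{cmonom jetvar n}]}.

Definition jet n (u : R -> 'M[C]_n) (x : R) (v : jetvar n) : C :=
  cderiven v.2 (fun y => u y v.1.1 v.1.2) x.

Definition dpoly_eval n (p : dpoly n) (u : R -> 'M[C]_n) (x : R) : C :=
  mmap idfun
    (fun m : {cmonom jetvar n} => \prod_(v <- finsupp m) jet u x v ^+ m v) p.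

Definition mxeval n (P : 'M[dpoly n]_n) (u : R -> 'M[C]_n) (x : R) : 'M[C]_n :=
  \matrix_(i, j) dpoly_eval (P i j) u x.

(* The variables (i, i, k) vanish at every u with zero diagonal, so Q is
   determined as a function of such u, and as a polynomial up to monomials
   containing diagonal variables. [mcoeff mone] is the constant term. *)
Definition is_Qfamily n (Q : nat -> 'M[dpoly n]_n) : Prop :=
  [/\ Q 0%N = map_mx (fun c : C => (malgC c : dpoly n)) (amx n),
      forall k i j, mcoeff mone (Q k.+1 i j) = 0
    & forall u : R -> 'M[C]_n, mxsmooth u -> zero_diag u -> forall k x,
        mxderiv (mxeval (Q k) u) x + mxcomm (u x) (mxeval (Q k) u x)
        = mxcomm (mxeval (Q k.+1) u x) (amx n)].

Definition laxA n (u : R -> 'M[C]_n) (x : R) (lam : C) : 'M[C]_n :=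
  lam *: amx n + u x.

Definition laxB n (Q : nat -> 'M[dpoly n]_n) (l : nat)
    (u : R -> 'M[C]_n) (x : R) (lam : C) : 'M[C]_n :=
  \sum_(k < l.+1) lam ^+ (l - k) *: mxeval (Q k) u x.

(* With 0-based indices, the (i, j) entry is (alpha^i lambda)^j. *)
Definition Vmx (n : nat) : 'M[{poly C}]_n :=
  \matrix_(i, j) ((alpha n ^+ i)%:P * 'X) ^+ j.

(* phi_n; it is the only such phi because Vmx has nonzero leading principal
   minors over the field of fractions C(X). [is_trig_mx] means lower
   triangular. *)
Definition is_GDphi n (phi : 'M[{poly C}]_n) : Prop :=
  exists phim : 'M[{poly C}]_n,
    [/\ is_trig_mx phim, is_trig_mx phi^T, (forall i, phi i i = 1)
      & Vmx n = phim *m phi].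

Definition mxhorner n (P : 'M[{poly C}]_n) (lam : C) : 'M[C]_n :=
  map_mx (fun p : {poly C} => p.[lam]) P.

Definition GD_reality n (phi : 'M[{poly C}]_n) (A : C -> 'M[C]_n) : Prop :=
  forall lam : C,
    invmx (mxhorner phi lam) *m A lam *m mxhorner phi lam =
    invmx (mxhorner phi (alpha n * lam)) *m A (alpha n * lam)
      *m mxhorner phi (alpha n * lam).

End GelfandDickeyDefs.

(* Main.v *)
Require Import Defs.
From mathcomp Require Import all_boot all_order all_algebra.
From mathcomp Require Import ring lra finmap.
From mathcomp.multinomials Require Import monalg.
From mathcomp Require Import all_classical all_reals all_analysis.
From mathcomp.real_closed Require Import complex.

(** Put t = 1 / lambda and let q = sum_k Q_k(u) t^k be the formal resolvent.
    The recursion says that q commutes with d/dx + lambda a + u.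

    The reality condition is a twisted commutation.  The rows of V (alpha lambda)
    are the cyclically shifted rows of V (lambda), and V (lambda) is homogeneous,
    so the LU factors give phi (alpha lambda) = (1 + lambda b) phi (lambda) for a
    constant superdiagonal matrix b with alpha a b = b a ([phi_twist]).  Hence A
    satisfies the condition exactly when
    (1 + lambda b) A (lambda) = A (alpha lambda) (1 + lambda b)
    ([GD_realityP]).  This couples each coefficient of A only with the next one,
    and for lambda a + u it reads u b - b u = (1 - alpha) a.

    Granting that lambda q satisfies the same relation as a Laurent series, so
    does lambda^(nj+1) q.  The relation survives cutting off the negative powers
    of lambda: the only coefficient where the cut could be seen is that of
    lambda^0, where the coupling factor 1 - alpha^0 vanishes ([laxB_twist]).

    It remains to see that D = (t + b) q - q' (t + b) is zero, where q' is
    alpha q with lambda replaced by alpha lambda ([Qpoly_twist]).  Both t + b and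
    the two resolvents intertwine the first-order operators, hence so does D, and
    its lowest nonzero coefficient D_m satisfies alpha a D_m = D_m a.  On the
    other hand q^n = 1 = q'^n, so the telescoping sum of q'^i D q^(n-1-i) is zero;
    its lowest coefficient is n D_m a^(n-1), and D_m = 0.

    Finally q^n = 1 ([Qpoly_exprn]) is where the absence of constant terms enters.
    The lowest coefficient of q^n - 1 commutes with a, so it is diagonal, and the
    next equation makes it constant in x.  It only depends on finitely many
    derivatives of u at the point, so u may be replaced by a polynomial function
    with the same jet at x and zero jet at x + 1 ([smooth_jet_to_0]); at x + 1 all
    Q_k with k > 0 vanish and q^n = a^n = 1.

    Power series in t are represented by polynomials truncated at degree K, and
    identities between them hold modulo t^K ([vanishes]). *)

Set Implicit Arguments.
Unset Strict Implicit.
Unset Printing Implicit Defensive.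

Import Order.TTheory GRing.Theory Num.Theory.
Import numFieldNormedType.Exports.

Local Open Scope ring_scope.
Local Open Scope complex_scope.

(** * The root of unity *)

Section Alpha.
Context {R : realType}.
Local Notation C := R[i].
Local Notation alpha := (@alpha R).

Lemma alphaX n k : alpha n ^+ k =
  cos (k%:R * (2 * pi / n%:R)) +i* sin (k%:R * (2 * pi / n%:R)).
Proof.
elim: k => [|k IH]; first by rewrite expr0 mul0r cos0 sin0.
have E (t : R) : k.+1%:R * t = k%:R * t + t by rewrite -natr1 mulrDl mul1r.
rewrite exprSr IH /alpha E cosD sinD.
by apply/eqP; rewrite eq_complex /= eqxx addrC eqxx.
Qed.

Lemma alpha_prim n : (0 < n)%N -> n.-primitive_root (alpha n).
Proof.
move=> n0; have nR : (n%:R : R) != 0 by rewrite pnatr_eq0 -lt0n.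
have alphan : alpha n ^+ n = 1.
  by rewrite alphaX mulrCA divff // mulr1 mulr_natl cos2pi sin2pi.
have [m mprim mn] := prim_order_exists n0 alphan.
suff /eqP mE : m == n by rewrite -{1}mE.
have m0 := prim_order_gt0 mprim; have := dvdn_leq n0 mn.
rewrite leq_eqVlt => /predU1P[->|mltn]; first exact: eqxx.
have := prim_expr_order mprim; rewrite alphaX => /eqP.
rewrite eq_complex /= => /andP[/eqP + _].
(* An order m < n would give cos (2 t) = 1 with 0 < t < pi. *)
set t := m%:R * (pi / n%:R) : R.
have -> : m%:R * (2 * pi / n%:R) = t *+ 2.
  by rewrite -mulrA mulrCA mulr_natl.
have t0 : 0 < sin t.
  apply: sin_gt0_pi; apply/andP; split; first by apply: mulr_gt0; rewrite ?divr_gt0 ?ltr0n ?pi_gt0.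
  rewrite /t mulrCA gtr_pMr; last exact: pi_gt0.
  by rewrite ltr_pdivrMr ?ltr0n // mul1r ltr_nat.
rewrite cos_mulr2n cos2sin2 => h.
have : sin t ^+ 2 != 0 by rewrite expf_eq0 /= gt_eqF.
by move/eqP; case; move: h; lra.
Qed.

Lemma alpha_neq0 n : (0 < n)%N -> alpha n != 0.
Proof.
move=> n_gt0; have := prim_expr_order (alpha_prim n_gt0).
by apply: contra_eq_neq => ->; rewrite expr0n gtn_eqF // eq_sym oner_eq0.
Qed.

End Alpha.

(** * Twist of the LU factor *)

(** Forward substitution: with s = 0 it transfers lower triangularity from L X
    to X, and with s = 1 the Hessenberg shape. *)
Lemma trig_mulmx_cancel (F : fieldType) n s (L X : 'M[F]_n) :
    is_trig_mx L -> (forall i, L i i != 0) ->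
    (forall i j : 'I_n, (i + s < j)%N -> (L *m X) i j = 0) ->
  forall i j : 'I_n, (i + s < j)%N -> X i j = 0.
Proof.
move=> /is_trig_mxP Ltrig Ldiag LX i j.
have [m] := ubnP (i : nat); elim: m i => // m IH i; rewrite ltnS => im isj.
have := LX _ _ isj; rewrite mxE (bigD1 i) //= big1 => [|k].
  by rewrite addr0 => /eqP; rewrite mulf_eq0 (negPf (Ldiag i)) => /eqP.
rewrite neq_ltn => /orP[ki|ik]; last by rewrite Ltrig ?mul0r.
rewrite IH ?mulr0 //; first exact: leq_trans im.
by apply: leq_ltn_trans isj; rewrite leq_add2r ltnW.
Qed.

Section Twist.
Context {R : realType}.
Local Notation C := R[i].
Local Notation alpha := (@alpha R).
Local Notation amx := (@amx R).
Local Notation Vmx := (@Vmx R).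

Definition powmx n (c : C) : 'M[C]_n := diag_mx (\row_i c ^+ i).

Lemma amxE n : amx n = powmx n (alpha n).
Proof. by []. Qed.

Lemma powmx_unit n c : c != 0 -> powmx n c \in unitmx.
Proof.
move=> c0; rewrite unitmxE det_diag unitfE; apply/prodf_neq0 => i _.
by rewrite mxE expf_neq0.
Qed.

Lemma powmxM n c d : powmx n (c * d) = powmx n c *m powmx n d.
Proof.
rewrite mulmx_diag; congr diag_mx.
by apply/rowP => i; rewrite !mxE exprMn.
Qed.

Lemma mxhornerM n (A B : 'M[{poly C}]_n) c :
  mxhorner (A *m B) c = mxhorner A c *m mxhorner B c.
Proof. exact: (map_mxM (horner_eval c)). Qed.

Lemma Vmx_hornerE n c :
  mxhorner (Vmx n) c = \matrix_(i, j) (alpha n ^+ i * c) ^+ j.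
Proof.
by apply/matrixP => i j; rewrite !mxE horner_exp hornerM hornerC hornerX.
Qed.

Section Phi.
Variables (n : nat) (n_gt0 : (0 < n)%N) (phi phim : 'M[{poly C}]_n).
Hypotheses (phim_trig : is_trig_mx phim) (phi_trig : is_trig_mx phi^T).
Hypotheses (phi1 : forall i, phi i i = 1) (VE : Vmx n = phim *m phi).

Local Notation P := (mxhorner phi).
Local Notation L := (mxhorner phim).

Let PL c : mxhorner (Vmx n) c = L c *m P c.
Proof. by rewrite VE mxhornerM. Qed.

Let P_diag c i : P c i i = 1.
Proof. by rewrite mxE phi1 hornerC. Qed.

Let P_trig c : is_trig_mx (P c)^T.
Proof.
apply/is_trig_mxP => i j ij; rewrite !mxE.
by move/is_trig_mxP: phi_trig => /(_ i j ij); rewrite mxE => ->; rewrite horner0.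
Qed.

Let L_trig c : is_trig_mx (L c).
Proof.
apply/is_trig_mxP => i j ij; rewrite !mxE.
by move/is_trig_mxP: phim_trig => /(_ i j ij) ->; rewrite horner0.
Qed.

Lemma phi_unit c : P c \in unitmx.
Proof.
rewrite unitmxE -det_tr det_trig // big1 ?unitr1 // => i _.
by rewrite mxE P_diag.
Qed.

Let V1_det : \det (mxhorner (Vmx n) 1) != 0.
Proof.
have -> : mxhorner (Vmx n) 1 = (Vandermonde n (\row_i alpha n ^+ i))^T.
  by apply/matrixP => i j; rewrite Vmx_hornerE !mxE mulr1.
rewrite det_tr det_Vandermonde; apply/prodf_neq0 => i _.
apply/prodf_neq0 => j ij; rewrite !mxE subr_eq0.
rewrite (eq_prim_root_expr (@alpha_prim R n n_gt0)) // !modn_small //.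
by rewrite gtn_eqF.
Qed.

Let L1_diag i : L 1 i i != 0.
Proof.
move: V1_det; rewrite PL det_mulmx mulf_eq0 negb_or => /andP[+ _].
by rewrite det_trig // => /prodf_neq0; apply.
Qed.

Let tr_upper (X Y : 'M[C]_n) c :
    X *m P c = Y -> (forall i j : 'I_n, (j < i)%N -> Y i j = 0) ->
  forall i j : 'I_n, (j < i)%N -> X i j = 0.
Proof.
move=> XY Y0 i j ji.
have := @trig_mulmx_cancel _ _ 0 (P c)^T X^T (P_trig c) _ _ j i.
rewrite addn0 => /(_ _ _ ji); rewrite mxE; apply.
  by move=> k; rewrite mxE P_diag oner_eq0.
by move=> k l; rewrite addn0 -trmx_mul XY mxE; exact: Y0.
Qed.

Let P_upper c (i j : 'I_n) : (j < i)%N -> P c i j = 0.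
Proof. by move=> ji; move/is_trig_mxP: (P_trig c) => /(_ _ _ ji); rewrite mxE. Qed.

Let upper_mulP_diag (X : 'M[C]_n) c i :
  (forall i j : 'I_n, (j < i)%N -> X i j = 0) -> (X *m P c) i i = X i i.
Proof.
move=> X0; rewrite mxE (bigD1 i) //= P_diag mulr1 big1 ?addr0 // => k.
rewrite neq_ltn => /orP[ki|ik]; first by rewrite X0 ?mul0r.
by rewrite P_upper ?mulr0.
Qed.

(** Uniqueness of the LU factorization applied to
    V (c) = V (1) diag (1, c, c^2, ...): the quotient of the two upper factors
    is both lower and upper triangular, and its diagonal is read off from the
    unit diagonals. *)
Lemma phi_homogeneous c : powmx n c *m P c = P 1 *m powmx n c.
Proof.
pose W := P 1 *m powmx n c *m invmx (P c).
have WP : W *m P c = P 1 *m powmx n c by exact: mulmxKV (phi_unit c) _.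
rewrite -WP; congr (_ *m _).
have W_upper : forall i j : 'I_n, (j < i)%N -> W i j = 0.
  apply: tr_upper WP _ => i j ji.
  by rewrite mul_mx_diag mxE P_upper ?mul0r.
have W_lower : forall i j : 'I_n, (i < j)%N -> W i j = 0.
  move=> i j ij; apply: (@trig_mulmx_cancel _ _ 0 (L 1)) => //; last by rewrite addn0.
  move=> k l; rewrite addn0 => kl.
  have -> : L 1 *m W = L c.
    rewrite -[RHS](mulmxK (phi_unit c)) -PL /W !mulmxA -PL; congr (_ *m _).
    rewrite mul_mx_diag; apply/matrixP => r s.
    by rewrite !Vmx_hornerE !mxE mulr1 exprMn.
  by move/is_trig_mxP: (L_trig c); apply.
clearbody W; apply/matrixP => i j; rewrite !mxE; have [<-|ij] := eqVneq i j.
  rewrite mulr1n -(upper_mulP_diag c i W_upper) WP mul_mx_diag mxE P_diag mul1r.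
  by rewrite mxE.
rewrite mulr0n; move: ij; rewrite neq_ltn => /orP[] ij.
  by rewrite W_lower.
by rewrite W_upper.
Qed.

(* Up to conjugation by L 1, the matrix H is the cyclic shift of the rows of
   V (1); upper triangular and Hessenberg, it is bidiagonal. *)
Let H := P 1 *m amx n *m invmx (P 1).

Let HP : H *m P 1 = P 1 *m amx n.
Proof. exact: mulmxKV (phi_unit 1) _. Qed.

Let H_upper (i j : 'I_n) : (j < i)%N -> H i j = 0.
Proof.
apply: tr_upper HP _ i j => i j ji.
by rewrite mul_mx_diag mxE P_upper ?mul0r.
Qed.

Let H_diag i : H i i = alpha n ^+ i.
Proof.
rewrite -(upper_mulP_diag 1 i H_upper) HP.
by rewrite mul_mx_diag !mxE phi1 hornerC mul1r.
Qed.

Let H_hessenberg (i j : 'I_n) : (i + 1 < j)%N -> H i j = 0.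
Proof.
move=> ij; apply: (@trig_mulmx_cancel _ _ 1 (L 1)) ij => // {}i {}j ij.
have -> : L 1 *m H = rowsub (@ordS n) (L 1).
  apply: (can_inj (mulmxK (phi_unit 1))).
  rewrite -mulmxA HP mulmxA -PL mul_rowsub_mx -PL mul_mx_diag.
  apply/matrixP => r s; rewrite !Vmx_hornerE !mxE !mulr1 /= -exprMn.
  by rewrite -exprSr (prim_expr_mod (@alpha_prim R n n_gt0)).
rewrite addn1 in ij; rewrite mxE; move/is_trig_mxP: (L_trig 1); apply => /=.
by rewrite modn_small; last exact: ltn_trans ij (ltn_ord j).
Qed.

(** The superdiagonal b for which a (1 + b) is the bidiagonal matrix H. *)
Definition twistmx : 'M[C]_n :=
  \matrix_(i, j) if j == i.+1 :> nat then alpha n ^- i * H i j else 0.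

Let al0 : alpha n != 0 := @alpha_neq0 R n n_gt0.

Lemma amx_twistmx : alpha n *: (amx n *m twistmx) = twistmx *m amx n.
Proof.
rewrite mul_mx_diag mul_diag_mx; apply/matrixP => i j; rewrite !mxE.
case: eqP => [->|_]; last by rewrite mul0r !mulr0.
by rewrite mulrA -exprS mulrC.
Qed.

Let twistmxE : amx n *m (1%:M + twistmx) = H.
Proof.
move: H_upper H_diag H_hessenberg; rewrite /twistmx.
generalize H => G G_upper G_diag G_hess; rewrite mul_diag_mx; apply/matrixP => i j; rewrite !mxE.
have [<-|ij] := eqVneq i j.
  by rewrite ltn_eqF // addr0 mulr1 G_diag.
rewrite mulr0n add0r; case: eqP => [_|/eqP nij].
  by rewrite mulVKf // expf_neq0.
rewrite mulr0; move: ij; rewrite neq_ltn => /orP[ij|ji]; last by rewrite G_upper.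
by rewrite G_hess // addn1 ltn_neqAle eq_sym nij.
Qed.

Lemma phi_twist c : c != 0 ->
  mxhorner phi (alpha n * c) = (1%:M + c *: twistmx) *m mxhorner phi c.
Proof.
move=> c0; apply: (can_inj (mulKmx (powmx_unit n (mulf_neq0 al0 c0)))).
rewrite phi_homogeneous powmxM -amxE mulmxA -HP -mulmxA -phi_homogeneous.
have comm_pow : (1%:M + twistmx) *m powmx n c = powmx n c *m (1%:M + c *: twistmx).
  rewrite mulmxDl mulmxDr mul1mx mulmx1; congr (_ + _).
  rewrite mul_mx_diag mul_diag_mx; apply/matrixP => i j; rewrite !mxE.
  case: eqP => [->|_]; last by rewrite mul0r !mulr0.
  by rewrite mulrA -exprSr mulrC.
rewrite -twistmxE -!(mulmxA (amx n)); congr (mulmx (amx n) _).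
by rewrite [LHS]mulmxA comm_pow [RHS]mulmxA.
Qed.

End Phi.

End Twist.

(** * Derivatives of complex, matrix and polynomial valued functions *)

Section ComplexDerivative.
Context {R : realType}.
Local Notation C := R[i].

(** Real and imaginary parts separately, since [cderiven] is taken on them;
    a relation, so that existence and value of the derivative come together. *)
Definition cder (f f' : R -> C) := forall x : R,
  is_derive x (1 : R) (fun y => complex.Re (f y)) (complex.Re (f' x)) /\
  is_derive x (1 : R) (fun y => complex.Im (f y)) (complex.Im (f' x)).

Lemma cder_cst c : cder (fun=> c) (fun=> 0).
Proof. by move=> x; split; exact: is_derive_cst. Qed.

Lemma cderD f f' g g' : cder f f' -> cder g g' ->
  cder (fun x => f x + g x) (fun x => f' x + g' x).
Proof.
move=> df dg x; have [fr fi] := df x; have [gr gi] := dg x; split.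
- have -> : (fun y => complex.Re (f y + g y)) =
      (fun y => complex.Re (f y)) + (fun y => complex.Re (g y)).
    by apply/funext => y; rewrite fctE; case: (f y) (g y) => [? ?] [? ?].
  have -> : complex.Re (f' x + g' x) = complex.Re (f' x) + complex.Re (g' x).
    by case: (f' x) (g' x) => [? ?] [? ?].
  exact: is_deriveD.
- have -> : (fun y => complex.Im (f y + g y)) =
      (fun y => complex.Im (f y)) + (fun y => complex.Im (g y)).
    by apply/funext => y; rewrite fctE; case: (f y) (g y) => [? ?] [? ?].
  have -> : complex.Im (f' x + g' x) = complex.Im (f' x) + complex.Im (g' x).
    by case: (f' x) (g' x) => [? ?] [? ?].
  exact: is_deriveD.
Qed.

Lemma cderM f f' g g' : cder f f' -> cder g g' ->
  cder (fun x => f x * g x) (fun x => f' x * g x + f x * g' x).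
Proof.
move=> df dg x; have [fr fi] := df x; have [gr gi] := dg x; split.
- have -> : (fun y => complex.Re (f y * g y)) =
      (fun y => complex.Re (f y)) * (fun y => complex.Re (g y)) -
      (fun y => complex.Im (f y)) * (fun y => complex.Im (g y)).
    by apply/funext => y; rewrite !fctE; case: (f y) (g y) => [? ?] [? ?].
  apply: is_derive_eq; rewrite /GRing.scale /=.
  by case: (f x) (f' x) (g x) (g' x) => [? ?] [? ?] [? ?] [? ?] /=; ring.
- have -> : (fun y => complex.Im (f y * g y)) =
      (fun y => complex.Re (f y)) * (fun y => complex.Im (g y)) +
      (fun y => complex.Im (f y)) * (fun y => complex.Re (g y)).
    by apply/funext => y; rewrite !fctE; case: (f y) (g y) => [? ?] [? ?].
  apply: is_derive_eq; rewrite /GRing.scale /=.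
  by case: (f x) (f' x) (g x) (g' x) => [? ?] [? ?] [? ?] [? ?] /=; ring.
Qed.

Lemma eq_cder f f' g g' :
  f =1 g -> f' =1 g' -> cder f f' -> cder g g'.
Proof. by move=> /funext -> /funext ->. Qed.

Lemma cder_sum I (r : seq I) (F F' : I -> R -> C) :
  (forall i, cder (F i) (F' i)) ->
  cder (fun x => \sum_(i <- r) F i x) (fun x => \sum_(i <- r) F' i x).
Proof.
move=> dF; elim: r => [|i r IH].
  by apply: eq_cder (cder_cst 0) => x; rewrite big_nil.
by apply: eq_cder (cderD (dF i) IH) => x; rewrite big_cons.
Qed.

Lemma cder_prod I (r : seq I) (F : I -> R -> C) :
  (forall i, exists f', cder (F i) f') ->
  exists f', cder (fun x => \prod_(i <- r) F i x) f'.
Proof.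
move=> dF; elim: r => [|i r [g dg]].
  by exists (fun=> 0); apply: eq_cder (cder_cst 1) => x; rewrite ?big_nil.
have [f df] := dF i; exists (fun x => f x * \prod_(j <- r) F j x + F i x * g x).
by apply: eq_cder (cderM df dg) => x; rewrite ?big_cons.
Qed.

Lemma cderX (f : R -> C) k :
  (exists f', cder f f') -> exists g, cder (fun x => f x ^+ k) g.
Proof.
move=> df; have [g dg] := @cder_prod _ (iota 0 k) (fun=> f) (fun=> df).
exists g; apply: eq_cder dg => // x.
by rewrite big_const_seq count_predT size_iota -Monoid.iteropE.
Qed.

Lemma cder_unique f f' : cder f f' -> forall x, cderiven 1 f x = f' x.
Proof.
move=> df x; have [fr fi] := df x; rewrite /cderiven !derive1n1 !derive1E.
by rewrite !derive_val; case: (f' x).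
Qed.

Lemma cder0_cst f : cder f (fun=> 0) -> forall x y, f x = f y.
Proof.
move=> df x y; apply/eqP; rewrite eq_complex; apply/andP; split; apply/eqP.
  by apply: (@is_derive_0_is_cst _ (fun z => complex.Re (f z))) => z; case: (df z).
by apply: (@is_derive_0_is_cst _ (fun z => complex.Im (f z))) => z; case: (df z).
Qed.

Section Matrix.
Variable n : nat.
Implicit Types M N : R -> 'M[C]_n.

Definition mxder M M' := forall i j, cder (fun x => M x i j) (fun x => M' x i j).

Lemma mxder_cst A : mxder (fun=> A) (fun=> 0).
Proof. by move=> i j; apply: eq_cder (cder_cst (A i j)) => // x; rewrite mxE. Qed.

Lemma mxderD M M' N N' : mxder M M' -> mxder N N' ->
  mxder (fun x => M x + N x) (fun x => M' x + N' x).
Proof.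
by move=> dM dN i j; apply: eq_cder (cderD (dM i j) (dN i j)) => x; rewrite mxE.
Qed.

Lemma mxderM M M' N N' : mxder M M' -> mxder N N' ->
  mxder (fun x => M x *m N x) (fun x => M' x *m N x + M x *m N' x).
Proof.
move=> dM dN i j.
apply: eq_cder (cder_sum _ (fun k => cderM (dM i k) (dN k j))) => x.
  by rewrite mxE.
by rewrite !mxE -big_split.
Qed.

Lemma mxder_sum I (r : seq I) (F F' : I -> R -> 'M[C]_n) :
  (forall i, mxder (F i) (F' i)) ->
  mxder (fun x => \sum_(i <- r) F i x) (fun x => \sum_(i <- r) F' i x).
Proof.
move=> dF i j; apply: eq_cder (cder_sum r (fun k => dF k i j)) => x;
  by rewrite summxE.
Qed.

Lemma mxderZ c M M' : mxder M M' -> mxder (fun x => c *: M x) (fun x => c *: M' x).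
Proof.
move=> dM i j; apply: eq_cder (cderM (cder_cst c) (dM i j)) => x; rewrite mxE //.
by rewrite mul0r add0r.
Qed.

Lemma mxder_unique M M' : mxder M M' -> forall x, mxderiv M x = M' x.
Proof.
by move=> dM x; apply/matrixP => i j; rewrite mxE (cder_unique (dM i j)).
Qed.

End Matrix.

Section MatrixPoly.
Variable n' : nat.
Local Notation MP := {poly 'M[C]_n'.+1}.

Definition pder (p p' : R -> MP) :=
  forall k, mxder (fun x => (p x)`_k) (fun x => (p' x)`_k).

Lemma eq_mxder M M' N N' : M =1 N -> M' =1 N' -> mxder M M' -> @mxder n'.+1 N N'.
Proof. by move=> /funext -> /funext ->. Qed.

Lemma pder_cst (p : MP) : pder (fun=> p) (fun=> 0).
Proof. by move=> k; apply: eq_mxder (mxder_cst p`_k) => // x; rewrite coef0. Qed.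

Lemma pderD p p' q q' : pder p p' -> pder q q' ->
  pder (fun x => p x + q x) (fun x => p' x + q' x).
Proof.
by move=> dp dq k; apply: eq_mxder (mxderD (dp k) (dq k)) => x; rewrite coefD.
Qed.

Lemma pderM p p' q q' : pder p p' -> pder q q' ->
  pder (fun x => p x * q x) (fun x => p' x * q x + p x * q' x).
Proof.
move=> dp dq k.
apply: eq_mxder (mxder_sum _ (fun i : 'I_k.+1 => mxderM (dp i) (dq (k - i)%N))) => x.
  by rewrite coefM.
by rewrite coefD !coefM -big_split.
Qed.

Lemma pderN p p' : pder p p' -> pder (fun x => - p x) (fun x => - p' x).
Proof.
move=> dp k; apply: eq_mxder (mxderZ (-1) (dp k)) => x;
  by rewrite coefN scaleN1r.
Qed.

End MatrixPoly.
End ComplexDerivative.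

(** * Jets and differential polynomials *)

Section DifferentialPolynomials.
Context {R : realType}.
Local Notation C := R[i].
Variable n : nat.
Implicit Types (p : @dpoly R n) (u w : R -> 'M[C]_n) (v : jetvar n).

Lemma cder_jet u v : mxsmooth u ->
  cder (fun x => jet u x v) (fun x => jet u x (v.1, v.2.+1)).
Proof.
move=> su x; rewrite /jet /cderiven /= !derive1E.
by have [dr di] := su v.1.1 v.1.2 v.2 x; split; apply: DeriveDef.
Qed.

Lemma cder_dpoly_eval p u : mxsmooth u -> exists g, cder (dpoly_eval p u) g.
Proof.
move=> su; rewrite /dpoly_eval.
pose h x (m : {cmonom jetvar n}) := \prod_(v <- finsupp m) jet u x v ^+ m v.
have dh (m : {cmonom jetvar n}) : exists g, cder (h^~ m) g.
  apply: cder_prod => v; apply: cderX; eexists; exact: cder_jet.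
have [g dg] := choice dh.
exists (fun x => \sum_(m <- msupp p) (0 * h x m + p@_m * g m x)).
exact: eq_cder (cder_sum _ (fun m => cderM (cder_cst p@_m) (dg m))).
Qed.

Lemma dpoly_evalC (c : C) u x : dpoly_eval (malgC c : dpoly n) u x = c.
Proof. by rewrite /dpoly_eval mmapU mdom1 big_seq_fset0 mulr1. Qed.

Definition dpoly_order p : nat :=
  (\max_(m <- msupp p) \max_(v <- finsupp m) v.2)%N.+1.

Lemma dpoly_orderP p (m : {cmonom jetvar n}) v :
  m \in msupp p -> v \in finsupp m -> (v.2 < dpoly_order p)%N.
Proof.
move=> pm mv; rewrite ltnS.
apply: (@leq_trans (\max_(v <- finsupp m) v.2)%N).
  exact: (@leq_bigmax_seq _ (enum_fset (finsupp m)) xpredT (fun v : jetvar n => v.2)).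
exact: (@leq_bigmax_seq _ (enum_fset (msupp p)) xpredT
  (fun m : {cmonom jetvar n} => \max_(v <- finsupp m) v.2)%N m pm isT).
Qed.

Lemma dpoly_eval_local p u w x y :
    (forall v, (v.2 < dpoly_order p)%N -> jet u x v = jet w y v) ->
  dpoly_eval p u x = dpoly_eval p w y.
Proof.
move=> uw; rewrite /dpoly_eval !mmapE; apply: eq_big_seq => m pm.
congr (_ * _); apply: eq_big_seq => v mv.
by rewrite uw // (dpoly_orderP pm mv).
Qed.

(** Every monomial other than 1 contains a variable, which vanishes. *)
Lemma dpoly_eval_jet0 p u x :
    (forall v, (v.2 < dpoly_order p)%N -> jet u x v = 0) ->
  dpoly_eval p u x = mcoeff mone p.
Proof.
move=> u0; rewrite /dpoly_eval mmapE.
have hm m : m \in msupp p -> m != mone ->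
    p@_m * \prod_(v <- finsupp m) jet u x v ^+ m v = 0.
  move=> pm m1; have [m0|[v mv]] := fset_0Vmem (finsupp m).
    case/eqP: m1; apply: mdeg_eq0I.
    by rewrite mdegE m0 big_seq_fset0.
  rewrite (big_fsetD1 v) //= u0 ?(dpoly_orderP pm mv) //.
  by rewrite expr0n cmE_eq0 mv mul0r mulr0.
have [p1|p1] := boolP (mone \in msupp p); last first.
  rewrite mcoeff_outdom // big_seq big1 // => m pm; apply: hm => //.
  by apply: contraNneq p1 => <-.
rewrite (big_fsetD1 _ p1) /= mdom1 big_seq_fset0 mulr1 big_seq big1 ?addr0 //.
by move=> m; rewrite in_fsetD1 => /andP[m1 pm]; exact: hm.
Qed.

End DifferentialPolynomials.

Section HermiteInterpolation.
Context {R : realType}.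
Implicit Types (p q : {poly R}) (c : R).

Lemma derivn_comp_shift p c k :
  (p \Po ('X - c%:P))^`(k) = p^`(k) \Po ('X - c%:P).
Proof.
elim: k => // k IH; rewrite !derivnS IH deriv_comp derivB derivX derivC subr0.
by rewrite mulr1.
Qed.

Lemma derivn_root_exp p c N k : (k < N)%N -> (p * ('X - c%:P) ^+ N)^`(k).[c] = 0.
Proof.
elim: k N p => [|k IH] [|N] p // kN.
  by rewrite derivn0 hornerM horner_exp !hornerE subrr expr0n mulr0.
rewrite derivSn derivM deriv_exp derivB derivX derivC subr0 mul1r exprS mulrA.
by rewrite mulrnAr -mulrnAl -mulrDl; exact: IH.
Qed.

(** The factor (1 - X^N)^N is 1 modulo X^N and divisible by (X - 1)^N, so it
    keeps the N-jet of the Taylor polynomial at c and kills the one at c + 1. *)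
Definition hermite_poly N (d : nat -> R) c : {poly R} :=
  ((1 - 'X^N) ^+ N * \poly_(k < N) (d k / k`!%:R)) \Po ('X - c%:P).

Lemma hermite_poly_left N d c k :
  (k < N)%N -> (hermite_poly N d c)^`(k).[c] = d k.
Proof.
move=> kN; rewrite derivn_comp_shift horner_comp hornerD hornerN hornerX hornerC.
rewrite subrr; set q := \poly_(_ < _) _.
have -> : (1 - 'X^N) ^+ N * q =
    q + (- (\sum_(i < N) (1 - 'X^N) ^+ i) * q) * ('X - 0%:P) ^+ N.
  rewrite subr0 -[X in X * q = _](subrK 1) subrX1 addrAC subrr add0r.
  by rewrite mulrDl mul1r addrC !mulNr; congr (_ - _); rewrite -mulrA mulrC.
rewrite derivnD hornerD derivn_root_exp // addr0 horner_coef0 coef_derivn addn0.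
by rewrite coef_poly kN ffactnn -[LHS]mulr_natr divfK //.
Qed.

Lemma hermite_poly_right N d c k :
  (k < N)%N -> (hermite_poly N d c)^`(k).[c + 1] = 0.
Proof.
move=> kN; rewrite derivn_comp_shift horner_comp hornerD hornerN hornerX hornerC.
rewrite [c + 1]addrC addrK; set q := \poly_(_ < _) _.
have -> : (1 - 'X^N) ^+ N * q =
    ((-1) ^+ N * ((\sum_(i < N) 'X^i) ^+ N * q)) * ('X - 1%:P) ^+ N.
  rewrite polyC1 -[1 - 'X^N]opprB subrX1 -[- (_ * _)]mulN1r !exprMn -!mulrA; congr (_ * _).
  by rewrite mulrC -!mulrA.
exact: derivn_root_exp.
Qed.

Lemma hermite_poly0 N c : hermite_poly N (fun=> 0) c = 0.
Proof.
rewrite /hermite_poly [\poly_(_ < _) _](_ : _ = 0) ?mulr0 ?comp_poly0 //.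
by apply/polyP => i; rewrite coef_poly coef0 mul0r if_same.
Qed.

Lemma derive1n_horner p k : derive1n k (horner p) = horner p^`(k).
Proof. by elim: k => // k IH; rewrite derive1nS IH -derivE -derivnS. Qed.

(** Differential polynomials of bounded order cannot distinguish u from w at c,
    nor the zero function from w at c + 1. *)
Lemma smooth_jet_to_0 n N (u : R -> 'M[R[i]]_n) c : zero_diag u ->
  exists w : R -> 'M[R[i]]_n, [/\ mxsmooth w, zero_diag w
    & forall v, (v.2 < N)%N -> jet w c v = jet u c v /\ jet w (c + 1) v = 0].
Proof.
move=> u0.
pose re i j := hermite_poly N (fun k => derive1n k (fun y => complex.Re (u y i j)) c) c.
pose im i j := hermite_poly N (fun k => derive1n k (fun y => complex.Im (u y i j)) c) c.
pose w x : 'M[R[i]]_n := \matrix_(i, j) ((re i j).[x] +i* (im i j).[x]).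
have wre i j : (fun y => complex.Re (w y i j)) = horner (re i j).
  by apply/funext => y; rewrite mxE.
have wim i j : (fun y => complex.Im (w y i j)) = horner (im i j).
  by apply/funext => y; rewrite mxE.
have diff0 k : derive1n k (fun=> 0 : R) c = 0.
  have -> : (fun=> 0 : R) = horner (0 : {poly R}).
    by apply/funext => y; rewrite horner0.
  by rewrite derive1n_horner (_ : 0^`(k) = 0) ?horner0 // linear0.
exists w; split.
- by move=> i j k x; rewrite wre wim !derive1n_horner; split; exact: derivable_horner.
- move=> x i; rewrite mxE /re /im.
  under [fun y => complex.Re _]eq_fun do rewrite u0.
  under [fun y => complex.Im _]eq_fun do rewrite u0.
  under [fun k => _]eq_fun do rewrite diff0.
  by rewrite hermite_poly0 horner0.
move=> [[i j] k] /= kN; rewrite /jet /cderiven /= wre wim !derive1n_horner.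
by rewrite !hermite_poly_left // !hermite_poly_right.
Qed.

End HermiteInterpolation.

(** * Truncated series and intertwining *)

Section Vanishing.
Variable A : nzRingType.
Implicit Types p q : {poly A}.

Definition vanishes K p := forall k, (k < K)%N -> p`_k = 0.

Lemma vanishesD K p q : vanishes K p -> vanishes K q -> vanishes K (p + q).
Proof. by move=> p0 q0 k kK; rewrite coefD p0 ?q0 ?addr0. Qed.

Lemma vanishesN K p : vanishes K p -> vanishes K (- p).
Proof. by move=> p0 k kK; rewrite coefN p0 ?oppr0. Qed.

Lemma vanishesMr K p q : vanishes K p -> vanishes K (p * q).
Proof.
move=> p0 k kK; rewrite coefM big1 // => i _.
by rewrite p0 ?mul0r // (leq_ltn_trans _ kK) // -ltnS.
Qed.

Lemma vanishesMl K p q : vanishes K p -> vanishes K (q * p).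
Proof.
move=> p0 k kK; rewrite coefM big1 // => i _.
by rewrite p0 ?mulr0 // (leq_ltn_trans _ kK) // leq_subr.
Qed.

Lemma coefM_vanishl m p q : vanishes m p -> (p * q)`_m = p`_m * q`_0.
Proof.
move=> p0; rewrite coefM big_ord_recr /= subnn big1 ?add0r // => i _.
by rewrite p0 ?mul0r.
Qed.

Lemma coefM_vanishr m p q : vanishes m p -> (q * p)`_m = q`_0 * p`_m.
Proof.
move=> p0; rewrite coefM big_ord_recl /= subn0 big1 ?addr0 // => i _.
by rewrite p0 ?mulr0 // /bump add1n subnSK // ?leq_subr.
Qed.

Lemma coef0X p j : (p ^+ j)`_0 = p`_0 ^+ j.
Proof. by elim: j => [|j IH]; rewrite ?coefC // !exprS coef0M IH. Qed.

(** The lowest coefficient of the telescoping sum of q^i (T p - q T) p^(j-1-i).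
    One factor a is multiplied on the right so that the exponent is j and not
    j - 1. *)
Lemma commutator_coef T p q a m :
    vanishes m (T * p - q * T) -> p`_0 = a ->
    q`_0 * (T * p - q * T)`_m = (T * p - q * T)`_m * a ->
  forall j, vanishes m (T * p ^+ j - q ^+ j * T) /\
    (T * p ^+ j - q ^+ j * T)`_m * a = ((T * p - q * T)`_m * a ^+ j) *+ j.
Proof.
set D := T * p - q * T => D0 pa qD.
have qjD j : q`_0 ^+ j * D`_m = D`_m * a ^+ j.
  elim: j => [|j IH]; first by rewrite !expr0 mul1r mulr1.
  by rewrite exprSr -mulrA qD mulrA IH exprSr mulrA.
elim=> [|j [IH0 IHm]].
  rewrite !expr0 mulr1 mul1r subrr coef0 mul0r mulr0n; split=> // k _.
  by rewrite coef0.
have -> : T * p ^+ j.+1 - q ^+ j.+1 * T = (T * p ^+ j - q ^+ j * T) * p + q ^+ j * D.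
  by rewrite /D [p ^+ _]exprSr [q ^+ j.+1]exprSr mulrBl mulrBr !mulrA addrA subrK.
split.
  by apply: vanishesD; [exact: vanishesMr|exact: vanishesMl].
rewrite coefD coefM_vanishl // coefM_vanishr // coef0X pa qjD mulrDl IHm.
by rewrite mulrnAl -!mulrA -!exprSr -mulrSr.
Qed.

End Vanishing.

(** The coefficients of q are those of d p with the variable scaled by c, and
    scaling is multiplicative. *)
Lemma coefX_rescale (F : comNzRingType) (A : algType F) (c d : F) (p q : {poly A}) :
    (forall k, q`_k = (c ^+ k * d) *: p`_k) ->
  forall j k, (q ^+ j)`_k = (c ^+ k * d ^+ j) *: (p ^+ j)`_k.
Proof.
move=> qp; elim=> [|j IH] k.
  rewrite !expr0 mulr1 coefC; case: eqP => [->|_]; last by rewrite scaler0.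
  by rewrite expr0 scale1r.
rewrite !exprS !coefM scaler_sumr; apply: eq_bigr => i _.
rewrite qp IH -scalerAl -scalerAr scalerA; congr (_ *: _).
by rewrite mulrACA -exprD subnKC // -ltnS.
Qed.

Section Intertwining.
Context {R : realType}.
Local Notation C := R[i].
Variable n' : nat.
Local Notation n := n'.+1.
Local Notation MP := {poly 'M[C]_n}.
Implicit Types (A : R -> MP) (p q : R -> MP) (u : R -> 'M[C]_n).

(** After multiplication by t, the relation says that p carries the operator
    t d/dx + A2 to t d/dx + A1 modulo t^K. *)
Definition intertwines K A1 A2 p := exists2 p', pder p p' &
  forall x, vanishes K ('X * p' x + (A1 x * p x - p x * A2 x)).

Lemma intertwinesM K A1 A2 A3 p q :
    intertwines K A1 A2 p -> intertwines K A2 A3 q ->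
  intertwines K A1 A3 (fun x => p x * q x).
Proof.
move=> [p' dp Ap] [q' dq Aq]; exists (fun x => p' x * q x + p x * q' x).
  exact: pderM.
move=> x.
have -> : 'X * (p' x * q x + p x * q' x) + (A1 x * (p x * q x) - p x * q x * A3 x) =
    ('X * p' x + (A1 x * p x - p x * A2 x)) * q x +
    p x * ('X * q' x + (A2 x * q x - q x * A3 x)).
  rewrite mulrDr [in RHS]mulrDl [in RHS]mulrDr [RHS]addrACA; congr (_ + _).
    by rewrite !mulrA (commr_polyX (p x)).
  by rewrite mulrBl mulrBr !mulrA addrA subrK.
by apply: vanishesD; [exact: vanishesMr|exact: vanishesMl].
Qed.

Lemma intertwinesB K A1 A2 p q :
    intertwines K A1 A2 p -> intertwines K A1 A2 q ->
  intertwines K A1 A2 (fun x => p x - q x).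
Proof.
move=> [p' dp Ap] [q' dq Aq]; exists (fun x => p' x - q' x).
  exact: pderD dp (pderN dq).
move=> x; rewrite mulrBr mulrBr mulrBl opprB.
have -> : 'X * p' x - 'X * q' x + (A1 x * p x - A1 x * q x + (q x * A2 x - p x * A2 x)) =
  ('X * p' x + (A1 x * p x - p x * A2 x)) - ('X * q' x + (A1 x * q x - q x * A2 x)).
  rewrite opprD [RHS]addrACA; congr (_ + _).
  by rewrite opprB addrACA [RHS]addrACA; congr (_ + _); rewrite addrC.
by apply: vanishesD => //; exact: vanishesN.
Qed.

Lemma intertwines1 K A : intertwines K A A (fun=> 1).
Proof.
exists (fun=> 0); first exact: pder_cst.
by move=> x; rewrite !mulr1 mul1r mulr0 subrr addr0 => k _; rewrite coef0.
Qed.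

Lemma intertwinesX K A p m :
  intertwines K A A p -> intertwines K A A (fun x => p x ^+ m).
Proof.
move=> Ap; elim: m => [|m IH]; first exact: intertwines1.
have -> : (fun x => p x ^+ m.+1) = (fun x => p x * p x ^+ m).
  by apply/funext => x; rewrite exprS.
exact: intertwinesM IH.
Qed.

(** This is t (lambda a + u). *)
Definition laxpoly (a : 'M[C]_n) u x : MP := a%:P + (u x)%:P * 'X.

Lemma coef_laxpoly (a1 a2 : 'M[C]_n) u x (p p' : MP) k :
  ('X * p' + (laxpoly a1 u x * p - p * laxpoly a2 u x))`_k =
  (if k is k0.+1 then p'`_k0 + (u x * p`_k0 - p`_k0 * u x) else 0) +
  (a1 * p`_k - p`_k * a2).
Proof.
rewrite /laxpoly mulrDl mulrDr mulrA -[_ * 'X * p]mulrA.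
rewrite -!(commr_polyX p) -(commr_polyX p') mulrA.
rewrite !(coefD, coefN, coefCM, coefMC, coefMX).
case: k => [|k] /=; first by rewrite !add0r !addr0.
by rewrite opprD addrACA [X in _ + X]addrC [LHS]addrA.
Qed.

(** The derivative enters the coefficient of t^m only through the coefficient
    of t^(m-1), which is identically zero in x. *)
Lemma intertwines_leading K (a1 a2 : 'M[C]_n) u p m :
    intertwines K (laxpoly a1 u) (laxpoly a2 u) p -> (m < K)%N ->
    (forall x, vanishes m (p x)) ->
  forall x, a1 * (p x)`_m = (p x)`_m * a2.
Proof.
move=> [p' dp Ap] mK p0 x; apply/eqP; rewrite -subr_eq0; apply/eqP.
have := Ap x m mK; rewrite coef_laxpoly; case: m mK p0 => [|m] mK p0.
  by rewrite add0r.
rewrite p0 // mulr0 mul0r subr0 addr0.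
suff -> : (p' x)`_m = 0 by rewrite add0r.
rewrite -(mxder_unique (dp m)); apply: mxder_unique x.
by apply: eq_mxder (mxder_cst 0) => // y; rewrite p0.
Qed.

Lemma intertwines_poly K (a1 a2 : 'M[C]_n) u (S S' : nat -> R -> 'M[C]_n) :
    (forall k, mxder (S k) (S' k)) -> (forall x, a1 * S 0%N x = S 0%N x * a2) ->
    (forall k x, S' k x + (u x * S k x - S k x * u x) +
                 (a1 * S k.+1 x - S k.+1 x * a2) = 0) ->
  intertwines K (laxpoly a1 u) (laxpoly a2 u) (fun x => \poly_(k < K) S k x).
Proof.
move=> dS S0 SS; exists (fun x => \poly_(k < K) S' k x).
  move=> k; case: (ltnP k K) => kK.
    by apply: eq_mxder (dS k) => x; rewrite coef_poly kK.
  by apply: eq_mxder (mxder_cst 0) => x; rewrite coef_poly ltnNge kK.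
move=> x [|k] kK; rewrite coef_laxpoly !coef_poly ?kK.
  by rewrite S0 subrr addr0.
by rewrite (ltnW kK) SS.
Qed.

End Intertwining.

(** * The resolvent *)

Section Resolvent.
Context {R : realType}.
Local Notation C := R[i].
Variable n' : nat.
Local Notation n := n'.+1.
Local Notation MP := {poly 'M[C]_n}.
Local Notation al := (@alpha R n).
Local Notation a := (@amx R n).
Implicit Types (u w : R -> 'M[C]_n).

Lemma mxder_mxeval (P : 'M[dpoly n]_n) u :
  mxsmooth u -> mxder (mxeval P u) (mxderiv (mxeval P u)).
Proof.
move=> su i j; have [g dg] := cder_dpoly_eval (P i j) su.
have E : (fun x => mxeval P u x i j) = dpoly_eval (P i j) u.
  by apply/funext => x; rewrite mxE.
have dgE := cder_unique dg.
by apply: eq_cder dg => x; rewrite mxE // E dgE.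
Qed.

Let al_prim : n.-primitive_root al := @alpha_prim R n isT.

Let al0 : al != 0 := @alpha_neq0 R n isT.

Lemma amxX k : a ^+ k = diag_mx (\row_i (al ^+ i) ^+ k).
Proof.
elim: k => [|k IH]; first by apply/matrixP => i j; rewrite !mxE expr0.
rewrite exprS IH -mulmxE mulmx_diag; congr diag_mx.
by apply/rowP => i; rewrite !mxE exprS.
Qed.

Lemma amx_order : a ^+ n = 1.
Proof.
rewrite amxX; apply/matrixP => i j; rewrite !mxE -exprM mulnC exprM.
by rewrite (prim_expr_order al_prim) expr1n.
Qed.

(** The diagonal entries of a are distinct. *)
Lemma amx_comm_diag (M : 'M[C]_n) i j : a * M = M * a -> i != j -> M i j = 0.
Proof.
rewrite -!mulmxE mul_diag_mx mul_mx_diag => /matrixP /(_ i j) + ij.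
rewrite !mxE mulrC => /eqP; rewrite -subr_eq0 -mulrBr mulf_eq0 => /predU1P[] //.
rewrite subr_eq0 (eq_prim_root_expr al_prim) !modn_small //.
by move/eqP/val_inj/eqP; rewrite (negPf ij).
Qed.

Variables (Q : nat -> 'M[@dpoly R n]_n) (QP : is_Qfamily Q).

Definition Qpoly K u x : MP := \poly_(k < K) mxeval (Q k) u x.

Lemma mxevalQ0 u x : mxeval (Q 0%N) u x = a.
Proof.
case: QP => -> _ _; apply/matrixP => i j; rewrite mxE [X in dpoly_eval X]mxE.
exact: dpoly_evalC.
Qed.

Lemma Qpoly_intertwines K u : mxsmooth u -> zero_diag u ->
  intertwines K (laxpoly a u) (laxpoly a u) (Qpoly K u).
Proof.
move=> su u0; case: QP => _ _ eqQ.
apply: (@intertwines_poly _ _ K a a u (fun k => mxeval (Q k) u)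
  (fun k => mxderiv (mxeval (Q k) u))) => [k|x|k x].
- exact: mxder_mxeval.
- by rewrite mxevalQ0.
- by rewrite -!mulmxE -/(mxcomm _ _) eqQ // /mxcomm addrA subrK subrr.
Qed.

(** Induction on the coefficient, for all smooth u with zero diagonal at once,
    since the argument replaces u by another function.  The coefficient of t^m
    is shown to be constant in x from the relation at t^(m+1), which is only
    available below K: this loses the last coefficient. *)
Lemma Qpoly_exprn K u : mxsmooth u -> zero_diag u ->
  forall x, vanishes K.-1 (Qpoly K u x ^+ n - 1).
Proof.
pose P u x := Qpoly K u x ^+ n - 1.
suff main m : (m.+1 < K)%N -> forall u, mxsmooth u -> zero_diag u ->
    forall x, (P u x)`_m = 0.
  move=> su u0 x m mK; apply: main => //.
  by rewrite -ltn_predRL.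
elim/ltn_ind: m => m IH mK {}u su u0 x.
have Pint w : mxsmooth w -> zero_diag w ->
    intertwines K (laxpoly a w) (laxpoly a w) (P w).
  move=> sw w0; apply: intertwinesB (intertwines1 _ _).
  exact: intertwinesX (Qpoly_intertwines _ sw w0).
have Plow w : mxsmooth w -> zero_diag w -> forall y, vanishes m (P w y).
  by move=> sw w0 y k km; apply: IH => //; exact: leq_ltn_trans km (ltnW mK).
have Pcomm w : mxsmooth w -> zero_diag w -> forall y,
    a * (P w y)`_m = (P w y)`_m * a.
  move=> sw w0; apply: intertwines_leading (Pint w sw w0) (ltnW mK) (Plow w sw w0).
have Pcst w : mxsmooth w -> zero_diag w -> forall y z, (P w y)`_m = (P w z)`_m.
  move=> sw w0 y z; apply/matrixP => i j.
  have [<-|ij] := eqVneq i j; last by rewrite !(amx_comm_diag _ ij) ?Pcomm.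
  have [p' dp Pp] := Pint w sw w0.
  (* On the diagonal of the relation at t^(m+1), both commutators vanish: the one
     with u because u has zero diagonal and the coefficient of t^m is diagonal. *)
  apply: (cder0_cst (f := fun y => (P w y)`_m i i)).
  apply: eq_cder (dp m i i) => // t.
  have := Pp t m.+1 mK; rewrite coef_laxpoly => /matrixP /(_ i i).
  rewrite -!mulmxE mul_diag_mx mul_mx_diag !mxE [al ^+ i * _]mulrC subrr addr0.
  rewrite (bigD1 i) //= w0 mul0r add0r big1 => [|k ki]; last first.
    by rewrite (amx_comm_diag (Pcomm w sw w0 t) ki) mulr0.
  rewrite (bigD1 i) //= w0 mulr0 add0r big1 => [|k ki]; last first.
    by rewrite eq_sym in ki; rewrite (amx_comm_diag (Pcomm w sw w0 t) ki) mul0r.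
  by rewrite addr0 subr0.
pose N := (\max_(k < K) \max_i \max_j dpoly_order (Q k i j))%N.
have QN k i j : (k < K)%N -> (dpoly_order (Q k i j) <= N)%N.
  move=> kK; apply: leq_trans (leq_bigmax (Ordinal kK)).
  apply: leq_trans (leq_bigmax i); exact: (leq_bigmax j).
have [w [sw w0 wu]] := smooth_jet_to_0 N x u0.
have uw : Qpoly K u x = Qpoly K w x.
  apply/polyP => k; rewrite !coef_poly.
  case: ltnP => // kK; apply/matrixP => i j; rewrite !mxE.
  apply: dpoly_eval_local => v vk.
  by have [-> _] := wu v (leq_trans vk (QN _ _ _ kK)).
rewrite [P u x]/P uw -/(P w x).
rewrite (Pcst w sw w0 x (x + 1)).
suff -> : P w (x + 1) = 0 by rewrite coef0.
suff qE : Qpoly K w (x + 1) = a%:P by rewrite /P qE -rmorphXn /= amx_order subrr.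
apply/polyP => k; rewrite coef_poly coefC.
case: ltnP => [kK|]; last by case: k => // K0; rewrite ltnNge (leq_trans K0) in mK.
case: k kK => [_|k kK] /=; first exact: mxevalQ0.
apply/matrixP => i j; rewrite !mxE dpoly_eval_jet0; first by case: QP.
by move=> v vk; have [_ ->] := wu v (leq_trans vk (QN _ _ _ kK)).
Qed.

Variables (u : R -> 'M[C]_n) (b : 'M[C]_n).
Hypotheses (u_smooth : mxsmooth u) (u_diag : zero_diag u).
Hypotheses (ab : al *: (a * b) = b * a).
Hypotheses (ub : forall x, u x * b - b * u x = a - al *: a).

(** The series alpha q with lambda replaced by alpha lambda, that is, with t
    replaced by t / alpha. *)
Definition rotQpoly K x : MP :=
  \poly_(k < K) ((al^-1 ^+ k * al) *: mxeval (Q k) u x).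

Lemma rotQpoly_intertwines K :
  intertwines K (laxpoly (al *: a) u) (laxpoly (al *: a) u) (rotQpoly K).
Proof.
case: QP => _ _ eqQ.
apply: (@intertwines_poly _ _ K (al *: a) (al *: a) u
  (fun k x => (al^-1 ^+ k * al) *: mxeval (Q k) u x)
  (fun k x => (al^-1 ^+ k * al) *: mxderiv (mxeval (Q k) u) x)) => [k|x|k x].
- exact/mxderZ/mxder_mxeval.
- by rewrite mxevalQ0 -!scalerAl -!scalerAr !scalerA mulrC.
rewrite -!scalerAl -!scalerAr !scalerA.
have -> : al * (al^-1 ^+ k.+1 * al) = al^-1 ^+ k * al.
  by rewrite exprSr (divfK al0) mulrC.
have -> : al^-1 ^+ k.+1 * al * al = al^-1 ^+ k * al.
  by rewrite exprSr (divfK al0).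
rewrite -!scalerBr -!scalerDr.
by rewrite -!mulmxE -/(mxcomm _ _) eqQ // /mxcomm addrA subrK subrr scaler0.
Qed.

(** An exact identity without derivatives, equivalent to the reality condition
    for lambda a + u together with alpha a b = b a. *)
Lemma twist_intertwines K :
  intertwines K (laxpoly (al *: a) u) (laxpoly a u) (fun=> 'X + b%:P).
Proof.
exists (fun=> 0); first exact: pder_cst.
move=> x k _; rewrite coef_laxpoly !(coefD, coefX, coefC, coef0).
case: k => [|[|[|k]]] /=; rewrite ?(coefD, coefX, coefC) /=
  ?(add0r, addr0, mulr0, mul0r, mulr1, mul1r, subrr, oppr0) //.
  by rewrite -scalerAl ab subrr.
by rewrite ub addrA subrK subrr.
Qed.

(** Strong induction on the coefficient: [intertwines_leading] lets a move across
    the lowest coefficient, and [commutator_coef] with exponent n then shows that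
    n times this coefficient is a coefficient of an expression in q^n - 1 and
    rotQpoly^n - 1, which vanish. *)
Lemma Qpoly_twist K x :
  vanishes K.-1 (('X + b%:P) * Qpoly K u x - rotQpoly K x * ('X + b%:P)).
Proof.
pose D x := ('X + b%:P) * Qpoly K u x - rotQpoly K x * ('X + b%:P).
have Dint : intertwines K (laxpoly (al *: a) u) (laxpoly a u) D.
  apply: intertwinesB.
    exact: intertwinesM (twist_intertwines K) (Qpoly_intertwines K u_smooth u_diag).
  exact: intertwinesM (rotQpoly_intertwines K) (twist_intertwines K).
move=> m; rewrite -/(D x) ltn_predRL => mK.
elim/ltn_ind: m mK x => m IH mK x.
have Dlow y : vanishes m (D y).
  by move=> k km; apply: IH => //; exact: leq_ltn_trans km (ltnW mK).
have K0 : (0 < K)%N by exact: leq_ltn_trans mK.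
have q0 : (Qpoly K u x)`_0 = a by rewrite coef_poly K0 mxevalQ0.
have rq k : (rotQpoly K x)`_k = (al^-1 ^+ k * al) *: (Qpoly K u x)`_k.
  by rewrite !coef_poly; case: ifP => // _; rewrite scaler0.
have r0 : (rotQpoly K x)`_0 = al *: a by rewrite rq expr0 mul1r q0.
have lead := intertwines_leading Dint (ltnW mK) Dlow x.
rewrite -r0 in lead.
have [_] := commutator_coef (Dlow x) q0 lead n.
have mK1 : (m < K.-1)%N by rewrite ltn_predRL.
have qn1 := @Qpoly_exprn K u u_smooth u_diag x.
have rn1 : vanishes K.-1 (rotQpoly K x ^+ n - 1).
  move=> k kK; have := qn1 k kK; rewrite !coefB (coefX_rescale rq) coefC.
  rewrite (prim_expr_order al_prim) mulr1 => /eqP; rewrite subr_eq0 => /eqP ->.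
  by case: k {kK} => [|k] /=; rewrite ?scale1r ?scaler0 subrr.
have -> : ('X + b%:P) * Qpoly K u x ^+ n - rotQpoly K x ^+ n * ('X + b%:P) =
    ('X + b%:P) * (Qpoly K u x ^+ n - 1) - (rotQpoly K x ^+ n - 1) * ('X + b%:P).
  by rewrite mulrBr mulrBl mulr1 mul1r opprB addrA subrK.
have D0 : vanishes K.-1 (('X + b%:P) * (Qpoly K u x ^+ n - 1) -
    (rotQpoly K x ^+ n - 1) * ('X + b%:P)).
  by apply: vanishesD; [exact: vanishesMl|apply: vanishesN; exact: vanishesMr].
rewrite (D0 m mK1) mul0r amx_order mulr1 -/(D x) => /esym/eqP.
by rewrite -scaler_nat scaler_eq0 pnatr_eq0 /= => /eqP.
Qed.

(** The coefficient of t^(k+1) in [Qpoly_twist]. *)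
Lemma Q_twist k x :
  mxeval (Q k) u x + b * mxeval (Q k.+1) u x =
  (al^-1 ^+ k * al) *: mxeval (Q k) u x +
  (al^-1 ^+ k.+1 * al) *: (mxeval (Q k.+1) u x * b).
Proof.
have := @Qpoly_twist k.+3 x k.+1 (leqnn _).
rewrite mulrDl mulrDr -(commr_polyX (Qpoly _ _ _)) coefB !coefD !coefMX /=.
rewrite coefCM coefMC !coef_poly leqnSn (leqW (leqnSn _)) -scalerAl.
by move/eqP; rewrite subr_eq0 => /eqP.
Qed.

(** With X_k and Y_k below, the difference of the two sides is the sum of
    c^(l-k) X_k + c^(l-k+1) Y_k.  It telescopes by X_k = - Y_(k+1), and the two
    ends Y_0 and X_l are zero; the latter because alpha^(l-k) is 1 at k = l. *)
Lemma laxB_twist l x c : al ^+ l = al ->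
  (1 + c *: b) * laxB Q l u x c = laxB Q l u x (al * c) * (1 + c *: b).
Proof.
move=> all; have alE k : (k <= l)%N -> al ^+ (l - k) = al^-1 ^+ k * al.
  move=> kl; have alk0 : al ^+ k != 0 by rewrite expf_neq0 // al0.
  by apply: (mulIf alk0); rewrite -exprD subnK // all exprVn mulrAC mulVf // mul1r.
pose q k := mxeval (Q k) u x; pose s k := al^-1 ^+ k * al.
pose X k := q k - s k *: q k; pose Y k := b * q k - s k *: (q k * b).
have Y0 : Y 0%N = 0.
  by rewrite /Y /s /q mxevalQ0 expr0 mul1r -ab subrr.
have XY k : X k = - Y k.+1.
  rewrite /X /Y opprB; apply/eqP; rewrite subr_eq addrAC eq_sym subr_eq eq_sym.
  by rewrite Q_twist addrC.
have Xl : X l = 0 by rewrite /X /s -alE // subnn scale1r subrr.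
apply/eqP; rewrite -subr_eq0 /laxB mulrDl mul1r mulrDr mulr1 opprD addrACA.
rewrite -sumrB -scalerAl -scalerAr mulr_sumr mulr_suml -scalerBr -sumrB scaler_sumr.
have -> : \sum_(k < l.+1) (c ^+ (l - k) *: q k - (al * c) ^+ (l - k) *: q k) =
    \sum_(k < l.+1) c ^+ (l - k) *: X k.
  apply: eq_bigr => k _; rewrite exprMn alE -1?ltnS // mulrC -scalerA -scalerBr //.
have -> : \sum_(k < l.+1) c *: (b * (c ^+ (l - k) *: q k) -
      (al * c) ^+ (l - k) *: q k * b) = \sum_(k < l.+1) c *: (c ^+ (l - k) *: Y k).
  apply: eq_bigr => k _; rewrite exprMn alE -1?ltnS // mulrC -scalerA.
  by rewrite -scalerAr -!scalerAl -scalerBr.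
rewrite big_ord_recr /= Xl scaler0 addr0 big_ord_recl /= Y0 !scaler0 add0r.
rewrite -big_split big1 // => k _ /=.
rewrite /bump add1n XY scalerN scalerA -exprS subnSK //.
by rewrite addNr.
Qed.

End Resolvent.

(** * The reality condition *)

(** Conjugating by phi (c) and using phi (alpha c) = (1 + c b) phi (c); at c = 0
    both sides of the reality condition coincide. *)
Lemma GD_realityP (R : realType) n (phi : 'M[{poly R[i]}]_n) :
    (0 < n)%N -> is_GDphi phi ->
  exists2 b : 'M[R[i]]_n, alpha n *: (amx n *m b) = b *m amx n &
  forall A : R[i] -> 'M[R[i]]_n, GD_reality phi A <->
    forall c, c != 0 ->
      (1%:M + c *: b) *m A c = A (alpha n * c) *m (1%:M + c *: b).
Proof.
move=> n_gt0 [phim [phim_trig phi_trig phi1 VE]].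
exists (twistmx phi); first exact: amx_twistmx.
have unitP c := phi_unit phi_trig phi1 c.
move=> A; split=> [GD c c0|tw c].
  have twE := phi_twist n_gt0 phim_trig phi_trig phi1 VE c0.
  have := GD c; move: (unitP (alpha n * c)) (unitP c); rewrite twE.
  set T := _ + _; set P := mxhorner phi c => TPu Pu GDc.
  apply: (can_inj (mulmxK Pu)); rewrite -[RHS]mulmxA.
  rewrite -(mulKVmx TPu (A _ *m _)) [invmx _ *m _]mulmxA -GDc.
  by rewrite !mulmxA mulmxK.
have [->|c0] := eqVneq c 0; first by rewrite mulr0.
have twE := phi_twist n_gt0 phim_trig phi_trig phi1 VE c0.
move: (unitP (alpha n * c)) (unitP c) (tw c c0); rewrite twE.
set T := _ + _; set P := mxhorner phi c => TPu Pu TA.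
apply: (can_inj (mulKmx TPu)); rewrite !mulmxA mulmxV // mul1mx.
by rewrite mulmxK // TA.
Qed.

Theorem mainTheorem19 (R : realType) (n : nat) (n_gt0 : (0 < n)%N)
    (phi : 'M[{poly R[i]}]_n) (phiP : is_GDphi phi)
    (Q : nat -> 'M[@dpoly R n]_n) (QP : is_Qfamily Q)
    (u : R -> 'M[R[i]]_n) (u_smooth : mxsmooth u) (u_diag : zero_diag u)
    (u_GD : forall x : R, GD_reality phi (laxA u x)) :
  forall j : nat,
    (forall x : R, GD_reality phi (laxA u x)) /\
    (forall x : R, GD_reality phi (laxB Q (n * j + 1)%N u x)).
Proof.
move=> j; split=> // x.
have [b ab GDE] := GD_realityP n_gt0 phiP.
apply/GDE => c _; case: n n_gt0 phi phiP Q QP u u_smooth u_diag u_GD b ab GDE => //.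
move=> n n_gt0 phi phiP Q QP u u_smooth u_diag u_GD b ab GDE.
apply: laxB_twist => //; last first.
  by rewrite addn1 exprS exprM (prim_expr_order (@alpha_prim R _ n_gt0)) expr1n mulr1.
move=> y; have /GDE /(_ 1 (oner_neq0 _)) := u_GD y.
rewrite /laxA mulr1 !scale1r mulmxDl mulmxDr mul1mx mulmx1 mulmxDr mulmxDl.
rewrite -scalemxAl ab ![_ + (b *m _ + _)]addrCA => /addrI.
rewrite ![_ + u y + _]addrAC => /addIr E; apply/eqP.
by rewrite subr_eq addrAC eq_sym subr_eq -!mulmxE E addrC.
Qed.
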